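(* Let $N$ and $H$ be frames, considered as monoids under binary meet, and let $f\colon H\to N$ be a monoid homomorphism. Then the Artin glueing $\mathrm{Gl}(f)$ (considered as a monoid under binary meet) is a $\lambda$-semidirect product of $H$ by $N$; that is, there is an action of inverse monoids $\alpha\colon H\times N\to N$ such that $N\ltimes_\alpha H=\mathrm{Gl}(f)$ as monoids.
   Context: A frame is a poset with finite meets and arbitrary joins in which finite meets distribute over arbitrary joins. A frame is a monoid under binary meet with unit the top element $1$; it is an inverse monoid (each element is idempotent and is its own inverse). Monoid homomorphisms between frames are exactly the finite-meet-preserving maps. For a finite-meet-preserving map $f\colon H\to N$ of frames, the Artin glueing $\mathrm{Gl}(f)$ is the frame of pairs $(n,h)\in N\times H$ with $n\le f(h)$, with componentwise meets and joins. For inverse monoids $N,H$, an action of inverse monoids of $H$ on $N$ is a function $\alpha\colon H\times N\to N$, $\alpha(h,n)=h\cdot n$, such that for all $h,h'\in H$, $n,n'\in N$: (1) $h\cdot(nn')=(h\cdot n)(h\cdot n')$; (2) $hh'\cdot n=h\cdot(h'\cdot n)$; (3) $1\cdot n=n$. (It is not required that $h\cdot 1=1$.) The associated $\lambda$-semidirect product $N\ltimes_\alpha H$ has underlying set $\{(n,h)\in N\times H : hh^{-1}\cdot n=n\}$ and multiplication $(n_1,h_1)(n_2,h_2)=\big(((h_1h_2)(h_1h_2)^{-1}\cdot n_1)(h_1\cdot n_2),\,h_1h_2\big)$; it is a monoid with identity $(1,1)$. *)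

(* Defs.v *)
From HB Require Import structures.
From mathcomp Require Import all_boot all_order.
From mathcomp Require Import boolp classical_sets.

Set Implicit Arguments.
Unset Strict Implicit.
Unset Printing Implicit Defensive.

Import Order.Theory DefaultProdOrder.

Local Open Scope group_scope.
Local Open Scope order_scope.

(* Binary joins and the bottom element are not required separately: they are
   the instances of [bigjoin] at pairs and at the empty set. *)
HB.mixin Record TMeetSemilattice_isFrame d (T : Type)
    of Order.TMeetSemilattice d T := {
  bigjoin : set T -> T;
  bigjoin_le : forall (A : set T) (z : T),
    bigjoin A <= z <-> (forall a, A a -> a <= z);
  meet_bigjoin : forall (x : T) (A : set T),
    x `&` bigjoin A = bigjoin (image A (fun a => x `&` a));
}.

#[short(type="frameType")]
HB.structure Definition Frame d :=
  { T of Order.TMeetSemilattice d T & TMeetSemilattice_isFrame d T }.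

Lemma bigjoin_ub d (F : frameType d) (A : set F) (a : F) :
  A a -> a <= bigjoin A.
Proof. by move: a; apply/bigjoin_le. Qed.

Section UniqueInverses.
Variables (G : semigroupType) (iv : G -> G).
Hypothesis mxVx : forall x : G, x * iv x * x = x.
Hypothesis mVxV : forall x : G, iv x * x * iv x = iv x.
Hypothesis iv_unique : forall x y : G,
  x * y * x = x -> y * x * y = y -> y = iv x.
Implicit Types x y e g : G.

Lemma unique_inverse_idem e : e * e = e -> iv e = e.
Proof. by move=> ee; apply/esym/iv_unique; rewrite !ee. Qed.

Lemma unique_inverse_idemM e g :
  e * e = e -> g * g = g -> (e * g) * (e * g) = e * g.
Proof.
move=> ee gg; set a := iv (e * g).
have aK : a * (e * g) * a = a by exact: mVxV.
have aE : g * a * e = a.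
  apply: iv_unique.
    rewrite -[RHS](mxVx (e * g)) -/a !mulgA.
    by rewrite -(mulgA e g g) gg -(mulgA _ e e) ee.
  rewrite -[in RHS]aK !mulgA.
  by rewrite -(mulgA _ e e) ee -(mulgA _ g g) gg.
have aa : a * a = a.
  by rewrite -[in LHS]aE -[RHS]aE -[in RHS]aK !mulgA.
have aV : e * g = iv a by apply: iv_unique; [exact: mVxV | exact: mxVx].
by rewrite aV (unique_inverse_idem aa) aa.
Qed.

Lemma unique_inverse_idemC e g : e * e = e -> g * g = g -> e * g = g * e.
Proof.
move=> ee gg.
have eg := unique_inverse_idemM ee gg; have ge := unique_inverse_idemM gg ee.
rewrite -[LHS](unique_inverse_idem eg); apply/esym/iv_unique.
  by rewrite !mulgA -(mulgA e g g) gg -(mulgA _ e e) ee -[LHS]mulgA eg.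
by rewrite !mulgA -(mulgA g e e) ee -(mulgA _ g g) gg -[LHS]mulgA ge.
Qed.

Lemma unique_inverseK : involutive iv.
Proof. by move=> x; apply/esym/iv_unique; [exact: mVxV | exact: mxVx]. Qed.

Lemma unique_inverseM : {morph iv : x y / x * y >-> y * x}.
Proof.
move=> x y.
have C : (y * iv y) * (iv x * x) = (iv x * x) * (y * iv y).
  by apply: unique_inverse_idemC; rewrite mulgA ?mxVx ?mVxV.
apply/esym/iv_unique.
  transitivity (x * ((y * iv y) * (iv x * x)) * y); first by rewrite !mulgA.
  by rewrite C !mulgA mxVx -!mulgA (mulgA y) mxVx.
transitivity (iv y * ((iv x * x) * (y * iv y)) * iv x); first by rewrite !mulgA.
by rewrite -C !mulgA mVxV -!mulgA (mulgA (iv x)) mVxV.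
Qed.

End UniqueInverses.

(* The [starMonoidType] laws are consequences of the remaining ones; see the
   factory [Monoid_isInverseMonoid] below. *)
HB.mixin Record StarMonoid_isInverseMonoid G of StarMonoid G := {
  mulgVg : forall x : G, x * x^-1 * x = x;
  mulVgV : forall x : G, x^-1 * x * x^-1 = x^-1;
  inverse_unique : forall x y : G,
    x * y * x = x -> y * x * y = y -> y = x^-1;
}.

#[short(type="inverseMonoidType")]
HB.structure Definition InverseMonoid :=
  { G of StarMonoid_isInverseMonoid G & StarMonoid G }.

HB.factory Record Monoid_isInverseMonoid G of Monoid G & BaseGroup G := {
  mulgVg : forall x : G, x * x^-1 * x = x;
  mulVgV : forall x : G, x^-1 * x * x^-1 = x^-1;
  inverse_unique : forall x y : G,
    x * y * x = x -> y * x * y = y -> y = x^-1;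
}.

HB.builders Context G of Monoid_isInverseMonoid G.
HB.instance Definition _ := Monoid_isStarMonoid.Build G
  (unique_inverseK mulgVg mulVgV inverse_unique)
  (unique_inverseM mulgVg mulVgV inverse_unique).
HB.instance Definition _ := StarMonoid_isInverseMonoid.Build G
  mulgVg mulVgV inverse_unique.
HB.end.

Section InverseMonoidTheory.
Variable G : inverseMonoidType.
Implicit Types x y : G.

Lemma mulgV_idem x : (x * x^-1) * (x * x^-1) = x * x^-1.
Proof. by rewrite mulgA mulgVg. Qed.

Lemma mulVg_idem x : (x^-1 * x) * (x^-1 * x) = x^-1 * x.
Proof. by rewrite mulgA mulVgV. Qed.

Lemma mulgVM x y : (x * y) * (x * y)^-1 * x = x * (y * y^-1).
Proof.
have C := unique_inverse_idemC (@mulgVg G) (@mulVgV G) (@inverse_unique G)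
  (mulgV_idem y) (mulVg_idem x).
transitivity (x * ((y * y^-1) * (x^-1 * x))); first by rewrite invgM !mulgA.
by rewrite C !mulgA mulgVg.
Qed.

Lemma mulgVMl x y :
  (x * y) * (x * y)^-1 * (x * x^-1) = (x * y) * (x * y)^-1.
Proof. by rewrite [LHS]mulgA mulgVM invgM !mulgA. Qed.

End InverseMonoidTheory.

(* Nothing is required of [act h 1]. *)
Record inverseAction (H N : inverseMonoidType) := InverseAction {
  act :> H -> N -> N;
  actM : forall h n n', act h (n * n') = act h n * act h n';
  actA : forall h h' n, act (h * h') n = act h (act h' n);
  act1 : forall n, act 1 n = n;
}.

Section LambdaSemidirect.
Variables (H N : inverseMonoidType) (alpha : inverseAction H N).

Record lambda_sdprod := LambdaSdprod {
  lambda_val : N * H;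
  _ : alpha (lambda_val.2 * (lambda_val.2)^-1) lambda_val.1 == lambda_val.1;
}.

HB.instance Definition _ := [isSub for lambda_val].
HB.instance Definition _ := [Choice of lambda_sdprod by <:].

Implicit Types x y z : lambda_sdprod.

Definition lambda_mul_val (x y : N * H) : N * H :=
  (alpha ((x.2 * y.2) * (x.2 * y.2)^-1) x.1 * alpha x.2 y.1, x.2 * y.2).

Lemma lambda_valP x : alpha ((val x).2 * ((val x).2)^-1) (val x).1 = (val x).1.
Proof. by apply/eqP; case: x. Qed.

Lemma lambda_act x y :
  alpha ((val x).2 * (val y).2 * ((val x).2 * (val y).2)^-1 * (val x).2)
    (val y).1 = alpha (val x).2 (val y).1.
Proof. by rewrite mulgVM actA lambda_valP. Qed.

Fact lambda_mul_subproof x y (u := lambda_mul_val (val x) (val y)) :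
  alpha (u.2 * u.2^-1) u.1 == u.1.
Proof.
by rewrite /u /= actM -!actA mulgV_idem lambda_act.
Qed.

Fact lambda_one_subproof (u := (1, 1) : N * H) :
  alpha (u.2 * u.2^-1) u.1 == u.1.
Proof. by rewrite /u /= invg1 mulg1 act1. Qed.

Definition lambda_mul x y : lambda_sdprod :=
  LambdaSdprod (lambda_mul_subproof x y).
Definition lambda_one : lambda_sdprod := LambdaSdprod lambda_one_subproof.

Fact lambda_mulA : associative lambda_mul.
Proof.
move=> x y z; apply/val_inj; rewrite /= /lambda_mul_val /=.
congr pair; last by rewrite mulgA.
set a := (val x).2; set b := (val y).2; set c := (val z).2.
by rewrite !actM -!actA (mulgA a b c) -(mulgA a b c) mulgVM (mulgA a b c) mulgVMl !mulgA.
Qed.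

Fact lambda_mul1 : left_id lambda_one lambda_mul.
Proof.
case=> -[n h] nP; have nE := eqP nP; apply/val_inj.
rewrite /= /lambda_mul_val /= !mul1g act1; rewrite /= in nE.
by congr pair; rewrite -[in LHS]nE -actM mul1g.
Qed.

Fact lambda_mulr1 : right_id lambda_one lambda_mul.
Proof.
case=> -[n h] nP; have nE := eqP nP; apply/val_inj.
rewrite /= /lambda_mul_val /= !mulg1; rewrite /= in nE.
by congr pair; rewrite nE -[in LHS]nE actA -actM mulg1 -actA.
Qed.

HB.instance Definition _ :=
  isMonoid.Build lambda_sdprod lambda_mulA lambda_mul1 lambda_mulr1.

End LambdaSemidirect.

(* An alias of [F], so that the monoid structure does not become an instance on
   every frame. *)
Definition meet_monoid d (F : frameType d) : Type := F.

Section MeetMonoid.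
Variables (d : Order.disp_t) (F : frameType d).

HB.instance Definition _ := Choice.on (meet_monoid F).
HB.instance Definition _ := isMonoid.Build (meet_monoid F)
  (@meetA d F) (@meet1x d F) (@meetx1 d F).
HB.instance Definition _ := hasInv.Build (meet_monoid F) id.

Fact meet_monoid_mulgVg (x : meet_monoid F) : x * x^-1 * x = x.
Proof. by rewrite /mul /inv /= !meetxx. Qed.

Fact meet_monoid_inverse_unique (x y : meet_monoid F) :
  x * y * x = x -> y * x * y = y -> y = x^-1.
Proof.
rewrite /mul /inv /= => xy yx.
by rewrite -yx -[RHS]xy meetAC meetxx [RHS]meetAC meetxx meetC.
Qed.

HB.instance Definition _ := Monoid_isInverseMonoid.Build (meet_monoid F)
  meet_monoid_mulgVg meet_monoid_mulgVg meet_monoid_inverse_unique.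

End MeetMonoid.

Section Glueing.
Variables (dH dN : Order.disp_t) (H : frameType dH) (N : frameType dN).
Variable f : UMagmaMorphism.type (meet_monoid H) (meet_monoid N).

Record glueing := Glueing {
  glueing_val : N * H;
  _ : glueing_val.1 <= (f glueing_val.2 : N);
}.

HB.instance Definition _ := [isSub for glueing_val].
HB.instance Definition _ := [Choice of glueing by <:].
HB.instance Definition _ :=
  Order.SubChoice_isSubPOrder.Build _ _ _ (Order.Disp tt tt) glueing.

Implicit Types x y z : glueing.

Lemma glueingP x : (val x).1 <= (f (val x).2 : N).
Proof. by case: x. Qed.

Lemma frame_morphI (h h' : H) : (f (h `&` h') : N) = (f h : N) `&` (f h' : N).
Proof. exact: (@gmulfM (meet_monoid H) (meet_monoid N) f h h'). Qed.

Lemma frame_morph1 : (f (\top : H) : N) = \top.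
Proof. exact: (@gmulf1 (meet_monoid H) (meet_monoid N) f). Qed.

Lemma frame_morph_homo (h h' : H) : h <= h' -> (f h : N) <= (f h' : N).
Proof. by move=> /meet_idPl hh'; rewrite -hh' frame_morphI leIr. Qed.

Fact glueing_meet_subproof x y (u := val x `&` val y : N * H) :
  u.1 <= (f u.2 : N).
Proof. by rewrite frame_morphI leI2 ?glueingP. Qed.

Definition glueing_meet x y : glueing := Glueing (glueing_meet_subproof x y).

Fact glueing_lexI x y z : (x <= glueing_meet y z) = (x <= y) && (x <= z).
Proof. exact: lexI. Qed.

HB.instance Definition _ :=
  Order.POrder_isMeetSemilattice.Build _ glueing glueing_lexI.

Fact glueing_top_subproof (u := \top : N * H) : u.1 <= (f u.2 : N).
Proof. by rewrite frame_morph1. Qed.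

Definition glueing_top : glueing := Glueing glueing_top_subproof.

Fact glueing_lex1 x : x <= glueing_top.
Proof. exact: lex1. Qed.

HB.instance Definition _ := Order.hasTop.Build _ glueing glueing_lex1.

Fact glueing_bigjoin_subproof (A : set glueing)
    (u := (bigjoin (image A (fun a => (val a).1)),
           bigjoin (image A (fun a => (val a).2))) : N * H) :
  u.1 <= (f u.2 : N).
Proof.
apply/bigjoin_le => _ [a Aa <-]; apply: le_trans (glueingP a) _.
by apply: frame_morph_homo; apply: bigjoin_ub; exists a.
Qed.

Definition glueing_bigjoin (A : set glueing) : glueing :=
  Glueing (glueing_bigjoin_subproof A).

Fact glueing_bigjoin_le (A : set glueing) (z : glueing) :
  glueing_bigjoin A <= z <-> (forall a, A a -> a <= z).
Proof.
split=> [/andP[/= /bigjoin_le l1 /bigjoin_le l2] a Aa|Az].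
  by apply/andP; split; [apply: l1 | apply: l2]; exists a.
by apply/andP; split; apply/bigjoin_le => _ [a /Az/andP[? ?] <-].
Qed.

Fact glueing_meet_bigjoin (x : glueing) (A : set glueing) :
  x `&` glueing_bigjoin A = glueing_bigjoin (image A (fun a => x `&` a)).
Proof.
by apply/val_inj; congr pair; rewrite /= meet_bigjoin !image_comp.
Qed.

HB.instance Definition _ := TMeetSemilattice_isFrame.Build _ glueing
  glueing_bigjoin_le glueing_meet_bigjoin.

End Glueing.

(* Main.v *)
Require Import Defs.
From HB Require Import structures.
From mathcomp Require Import all_boot all_order.

(** The action is [h . n = f h /\ n].  Since [h h^-1 = h] for meets, the condition
    [h h^-1 . n = n] says exactly [n <= f h], and when [n1 <= f h1] and
    [n2 <= f h2] the first component [f (h1 /\ h2) /\ n1 /\ f h1 /\ n2] of the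
    product collapses to [n1 /\ n2]. *)

Import Order.Theory.
Local Open Scope group_scope.
Local Open Scope order_scope.

Lemma meet_monoid_mulgV d (F : frameType d) (x : meet_monoid F) : x * x^-1 = x.
Proof. exact: meetxx. Qed.

Section GlueingAction.
Variables (dN dH : Order.disp_t) (N : frameType dN) (H : frameType dH).
Variable f : UMagmaMorphism.type (meet_monoid H) (meet_monoid N).

(** The action determines [f]: it sends the top element to [f h], in general not to the top. *)
Definition glueing_act (h : meet_monoid H) (n : meet_monoid N) :
  meet_monoid N := f h * n.

(** Idempotence of meet merges the two copies of [f h] on the right. The other two axioms come from
    [f] preserving binary meets and the top. *)
Fact glueing_actM h n n' :
  glueing_act h (n * n') = glueing_act h n * glueing_act h n'.
Proof. by rewrite /glueing_act /mul /= meetACA meetxx. Qed.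

Fact glueing_actA h h' n :
  glueing_act (h * h') n = glueing_act h (glueing_act h' n).
Proof. by rewrite /glueing_act gmulfM mulgA. Qed.

Fact glueing_act1 n : glueing_act 1 n = n.
Proof. by rewrite /glueing_act gmulf1 mul1g. Qed.

Definition glueing_action : inverseAction (meet_monoid H) (meet_monoid N) :=
  InverseAction glueing_actM glueing_actA glueing_act1.

(** Both carriers are thus cut out of [N * H] by one condition, so the maps between them only
    repackage a pair. *)
Lemma glueing_action_fix (u : meet_monoid N * meet_monoid H) :
  (glueing_action (u.2 * u.2^-1) u.1 == u.1) = ((u.1 : N) <= f u.2).
Proof. by rewrite meet_monoid_mulgV -eq_meetr. Qed.

Fact glueing_of_lambda_subproof (x : lambda_sdprod glueing_action) :
  ((lambda_val x).1 : N) <= f (lambda_val x).2.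
Proof. by rewrite -glueing_action_fix; case: x. Qed.

Definition glueing_of_lambda (x : lambda_sdprod glueing_action) :
    meet_monoid (glueing f) :=
  Glueing (glueing_of_lambda_subproof x).

Fact lambda_of_glueing_subproof (y : glueing f)
    (u := glueing_val y : meet_monoid N * meet_monoid H) :
  glueing_action (u.2 * u.2^-1) u.1 == u.1.
Proof. by rewrite glueing_action_fix; apply: glueingP. Qed.

Definition lambda_of_glueing (y : meet_monoid (glueing f)) :
    lambda_sdprod glueing_action :=
  LambdaSdprod (lambda_of_glueing_subproof y).

Lemma glueing_of_lambda_bij : bijective glueing_of_lambda.
Proof.
(* Both round trips leave the underlying pair unchanged. *)
exists lambda_of_glueing => x; first exact: val_inj.
exact: (@val_inj _ _ (glueing f)).
Qed.

Fact glueing_of_lambdaM : {morph glueing_of_lambda : x y / x * y}.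
Proof.
move=> x y; apply: (@val_inj _ _ (glueing f)).
have := glueing_of_lambda_subproof x; have := glueing_of_lambda_subproof y.
case: x y => [[n1 h1] ?] [[n2 h2] ?] /= le2 le1.
rewrite /mul /= /lambda_mul_val /=; congr pair.
rewrite meet_monoid_mulgV /glueing_act gmulfM /mul /=.
(* [n1] absorbs both copies of [f h1], and [n2] absorbs [f h2]. *)
by rewrite (meetAC (f h1 : N)) (meet_r le1) meetACA (meet_l le1) (meet_r le2).
Qed.

Fact glueing_of_lambda1 : glueing_of_lambda 1 = 1.
Proof. exact: (@val_inj _ _ (glueing f)). Qed.

HB.instance Definition _ :=
  isUMagmaMorphism.Build _ _ glueing_of_lambda
    (conj glueing_of_lambda1 glueing_of_lambdaM).

End GlueingAction.

Theorem proposition5p1 (dN dH : Order.disp_t)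
    (N : frameType dN) (H : frameType dH)
    (f : UMagmaMorphism.type (meet_monoid H) (meet_monoid N)) :
  exists (alpha : inverseAction (meet_monoid H) (meet_monoid N))
         (phi : UMagmaMorphism.type (lambda_sdprod alpha)
                                    (meet_monoid (glueing f))),
    bijective phi /\ (forall x, glueing_val (phi x) = lambda_val x).
Proof.
exists (glueing_action dN dH N H f), (glueing_of_lambda dN dH N H f).
(* The map is the identity on pairs by computation; in this sense the two monoids are equal. *)
by split=> //; apply: glueing_of_lambda_bij.
Qed.
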